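(* Let $G$ be a non-commutative directed po-group. The following statements are equivalent: (i) the right wreath product $\mathbb Z\,\overrightarrow{\mathrm{wr}}\,G$ satisfies RDP$_1$; (ii) the left wreath product $\mathbb Z\,\overleftarrow{\mathrm{wr}}\,G$ satisfies RDP$_1$; (iii) $G$ is a linearly ordered group. In any such case, the right and left wreath products are linearly ordered groups.
   Context: A po-group is a group $G$ (not necessarily Abelian; written here multiplicatively with neutral element $e$) endowed with a partial order $\le$ such that $a\le b$ implies $xay\le xby$ for all $x,y\in G$. Its positive cone is $G^+=\{g\in G: g\ge e\}$. It is linearly ordered if $\le$ is a total order. It is directed if for all $g_1,g_2\in G$ there is $g\in G$ with $g_1,g_2\le g$. Right and left wreath products: for a po-group $G$, let $W$ be the set of all pairs $(n,\langle g_i: i\in\mathbb Z\rangle)$ with $n\in\mathbb Z$, $g_i\in G$, and $g_i=e$ for all but finitely many $i\in\mathbb Z$, with the group operation $$(n,\langle g_i\rangle)*(m,\langle h_i\rangle)=(n+m,\langle g_i h_{i+n}: i\in\mathbb Z\rangle).$$ The right wreath product $\mathbb Z\,\overrightarrow{\mathrm{wr}}\,G$ is the group $W$ ordered by: $(n,\langle x_i\rangle)\le(m,\langle y_i\rangle)$ iff the two elements are equal, or $n<m$, or $n=m$ and $x_{i_0}<y_{i_0}$ where $i_0=\max\{i\in\mathbb Z: x_i\ne y_i\}$. The left wreath product $\mathbb Z\,\overleftarrow{\mathrm{wr}}\,G$ is the group $W$ ordered in the same way but with $i_0=\min\{i\in\mathbb Z: x_i\ne y_i\}$. Both are po-groups.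 A po-group $G$ satisfies RDP$_1$ if for all $a_1,a_2,b_1,b_2\in G^+$ with $a_1a_2=b_1b_2$ there are $c_{11},c_{12},c_{21},c_{22}\in G^+$ such that $a_1=c_{11}c_{12}$, $a_2=c_{21}c_{22}$, $b_1=c_{11}c_{21}$, $b_2=c_{12}c_{22}$, and such that $e\le x\le c_{12}$ and $e\le y\le c_{21}$ imply $xy=yx$. *)

(* Defs.v *)
From HB Require Import structures.
From mathcomp Require Import all_boot all_order all_algebra finmap.
From mathcomp Require Import boolp.

Set Implicit Arguments.
Unset Strict Implicit.
Unset Printing Implicit Defensive.

Import Order.TTheory GRing.Theory Num.Theory.

Local Open Scope order_scope.
Local Open Scope group_scope.

HB.mixin Record Group_isPOGroup (d : Order.disp_t) G
    of Group G & Order.POrder d G := {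
  le_mulg2 : forall x y a b : G, a <= b -> x * a * y <= x * b * y
}.

#[short(type="poGroupType")]
HB.structure Definition POGroup (d : Order.disp_t) :=
  { G of Group G & Order.POrder d G & Group_isPOGroup d G }.

Definition linearly_ordered (d : Order.disp_t) (G : poGroupType d) : Prop :=
  total (<=%O : rel G).

Definition directed (d : Order.disp_t) (G : poGroupType d) : Prop :=
  forall g1 g2 : G, exists g : G, g1 <= g /\ g2 <= g.

Definition RDP1 (d : Order.disp_t) (G : poGroupType d) : Prop :=
  forall a1 a2 b1 b2 : G,
    1 <= a1 -> 1 <= a2 -> 1 <= b1 -> 1 <= b2 -> a1 * a2 = b1 * b2 ->
  exists c11 c12 c21 c22 : G,
    [/\ [/\ 1 <= c11, 1 <= c12, 1 <= c21 & 1 <= c22],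
        [/\ a1 = c11 * c12, a2 = c21 * c22, b1 = c11 * c21 & b2 = c12 * c22]
      & forall x y : G, 1 <= x <= c12 -> 1 <= y <= c21 -> x * y = y * x].

Definition wreath (G : groupType) : Type := (int * {fsfun int -> G with 1%g})%type.

Section WreathGroup.
Variable G : groupType.
Implicit Types x y z : wreath G.

HB.instance Definition _ := Choice.on (wreath G).

Definition wreath_one : wreath G := (0%R, [fsfun with 1%g]).

(* The finite set after [in] bounds the support; see [wreath_mulE]. *)
Definition wreath_mul x y : wreath G :=
  ((x.1 + y.1)%R,
   [fsfun i in (finsupp x.2 `|` [fset (j - x.1)%R | j in finsupp y.2])%fset
      => x.2 i * y.2 (i + x.1)%R | 1%g]).

Definition wreath_inv x : wreath G :=
  ((- x.1)%R,
   [fsfun i in [fset (j + x.1)%R | j in finsupp x.2]%fset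
      => (x.2 (i - x.1)%R)^-1 | 1%g]).

Lemma wreath_mulE x y i : (wreath_mul x y).2 i = x.2 i * y.2 (i + x.1)%R.
Proof.
rewrite /= fsfunE inE; have [xi|xi] /= := finsuppP x.2 i => //.
rewrite mul1g; case: imfsetP => // H.
case: (finsuppP y.2 (i + x.1)%R) => // yi.
by case: H; exists (i + x.1)%R; rewrite ?addrK.
Qed.

Lemma wreath_invE x i : (wreath_inv x).2 i = (x.2 (i - x.1)%R)^-1.
Proof.
rewrite /= fsfunE; case: imfsetP => // H.
case: (finsuppP x.2 (i - x.1)%R) => [|xi]; first by rewrite invg1.
by case: H; exists (i - x.1)%R; rewrite ?subrK.
Qed.

Lemma wreath_oneE i : wreath_one.2 i = 1.
Proof. by rewrite fsfunE. Qed.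

Lemma wreathP x y : x.1 = y.1 -> x.2 =1 y.2 -> x = y.
Proof. by case: x y => [n f] [m g] /= -> /fsfunP ->. Qed.

Fact wreath_mulgA : associative wreath_mul.
Proof.
move=> x y z; apply: wreathP => [|i]; first exact: addrA.
by rewrite !wreath_mulE /= mulgA addrA.
Qed.

Fact wreath_mul1g : left_id wreath_one wreath_mul.
Proof.
move=> x; apply: wreathP => [|i]; first exact: add0r.
by rewrite wreath_mulE wreath_oneE mul1g addr0.
Qed.

Fact wreath_mulg1 : right_id wreath_one wreath_mul.
Proof.
move=> x; apply: wreathP => [|i]; first exact: addr0.
by rewrite wreath_mulE wreath_oneE mulg1.
Qed.

Fact wreath_mulVg : left_inverse wreath_one wreath_inv wreath_mul.
Proof.
move=> x; apply: wreathP => [|i]; first exact: addNr.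
by rewrite wreath_mulE wreath_oneE wreath_invE mulVg.
Qed.

Fact wreath_mulgV : right_inverse wreath_one wreath_inv wreath_mul.
Proof.
move=> x; apply: wreathP => [|i]; first exact: addrN.
by rewrite wreath_mulE wreath_oneE wreath_invE addrK mulgV.
Qed.

HB.instance Definition _ := isGroup.Build (wreath G) wreath_mulgA
  wreath_mul1g wreath_mulg1 wreath_mulVg wreath_mulgV.

Lemma mulwE x y i : (x * y).2 i = x.2 i * y.2 (i + x.1)%R.
Proof. exact: wreath_mulE. Qed.

End WreathGroup.

(* The index [i0] is the last one, with respect to [r], where [x] and [y]
   differ: the greatest one if [r] is [<=], the least one if [r] is [>=]. *)
Definition wreath_lt (d : Order.disp_t) (G : poGroupType d) (r : rel int)
    (x y : wreath G) : Prop :=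
  (x.1 < y.1)%R \/
  x.1 = y.1 /\ exists i0 : int,
    [/\ x.2 i0 != y.2 i0, forall i, x.2 i != y.2 i -> r i i0
      & x.2 i0 < y.2 i0].

Section WreathOrder.
Variables (d : Order.disp_t) (G : poGroupType d) (r : rel int).
Hypothesis r_total : total r.
Hypothesis r_anti : antisymmetric r.
Hypothesis r_trans : transitive r.
Hypothesis r_shift : forall n i j : int, r (i + n)%R (j + n)%R = r i j.
Implicit Types x y z : wreath G.

Lemma lt_mulg2 (g h a b : G) : a < b -> g * a * h < g * b * h.
Proof.
rewrite !lt_neqAle => /andP[ab leab]; rewrite le_mulg2 // andbT.
by apply: contraNneq ab => /mulIg/mulgI ->.
Qed.

Lemma wreath_lt_irr x : ~ wreath_lt r x x.
Proof.
by case=> [|[_ [i []]]]; rewrite ?ltxx ?eqxx.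
Qed.

Lemma wreath_lt_trans x y z :
  wreath_lt r x y -> wreath_lt r y z -> wreath_lt r x z.
Proof.
case=> [xy|[exy [i [_ Hi lti]]]] [yz|[eyz [j [_ Hj ltj]]]].
- by left; apply: lt_trans xy yz.
- by left; rewrite -eyz.
- by left; rewrite exy.
right; split; first by rewrite exy.
have D k : x.2 k != z.2 k -> (x.2 k != y.2 k) || (y.2 k != z.2 k).
  by case: (eqVneq (x.2 k) (y.2 k)) => //= ->.
have [eij|nij] := eqVneq i j.
  subst j; have lt := lt_trans lti ltj; exists i; split=> //.
    by rewrite lt_eqF.
  by move=> k /D/orP[/Hi|/Hj].
have [rij|rji] := orP (r_total i j).
- have exj : x.2 j = y.2 j.
    apply/eqP; apply: contraNT nij => /Hi rji.
    by apply/eqP/r_anti; rewrite rij.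
  exists j; rewrite exj lt_eqF //; split=> // k /D/orP[/Hi rk|/Hj //].
  exact: r_trans rk rij.
- have eyi : y.2 i = z.2 i.
    apply/eqP; apply: contraNT nij => /Hj rij.
    by apply/eqP/r_anti; rewrite rij.
  exists i; rewrite -eyi lt_eqF //; split=> // k /D/orP[/Hi //|/Hj rk].
  exact: r_trans rk rji.
Qed.

Lemma wreath_lt_mul (g h a b : wreath G) :
  wreath_lt r a b -> wreath_lt r (g * a * h) (g * b * h).
Proof.
case=> [ab|[eab [i [nab Hi lti]]]].
  by left; rewrite /= ltrD2r ltrD2l.
right; split; first by rewrite /= eab.
have E k : (g * a * h).2 k != (g * b * h).2 k ->
    a.2 (k + g.1)%R != b.2 (k + g.1)%R.
  by rewrite !mulwE /= eab; apply: contraNneq => ->.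
have lt : (g * a * h).2 (i - g.1)%R < (g * b * h).2 (i - g.1)%R.
  by rewrite !mulwE /= eab subrK; apply: lt_mulg2.
exists (i - g.1)%R; split=> [|k /E/Hi|//]; first by rewrite lt_eqF.
by rewrite -(r_shift g.1 k) subrK.
Qed.

Lemma wreath_ltb_irr : irreflexive (fun x y => `[< wreath_lt r x y >]).
Proof. by move=> x; apply/asboolPn/wreath_lt_irr. Qed.

Lemma wreath_ltb_trans : transitive (fun x y => `[< wreath_lt r x y >]).
Proof.
by move=> y x z /asboolP xy /asboolP yz; apply/asboolP/(wreath_lt_trans xy yz).
Qed.

End WreathOrder.

Definition rwreath (d : Order.disp_t) (G : poGroupType d) : Type := wreath G.
Definition lwreath (d : Order.disp_t) (G : poGroupType d) : Type := wreath G.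

Section RightWreath.
Variables (d : Order.disp_t) (G : poGroupType d).

Fact rwreath_lt_irr :
  irreflexive (fun x y : rwreath G => `[< wreath_lt <=%R x y >]).
Proof. exact: wreath_ltb_irr. Qed.

Fact rwreath_lt_trans :
  transitive (fun x y : rwreath G => `[< wreath_lt <=%R x y >]).
Proof. exact: wreath_ltb_trans le_total le_anti le_trans. Qed.

HB.instance Definition _ := Group.on (rwreath G).
HB.instance Definition _ :=
  Order.Lt_isPOrder.Build d (rwreath G) rwreath_lt_irr rwreath_lt_trans.

Lemma rwreath_leP (x y : rwreath G) :
  x <= y <-> x = y \/ wreath_lt <=%R x y.
Proof.
rewrite le_eqVlt; split=> [/orP[/eqP|/asboolP]|[->|xy]]; auto.
  by rewrite eqxx.
by apply/orP; right; apply/asboolP.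
Qed.

Fact rwreath_le_mul (x y a b : rwreath G) : a <= b -> x * a * y <= x * b * y.
Proof.
move=> /rwreath_leP[->//|ab]; apply/rwreath_leP; right.
by apply: wreath_lt_mul ab => n i j; rewrite lerD2r.
Qed.

HB.instance Definition _ :=
  Group_isPOGroup.Build d (rwreath G) rwreath_le_mul.

End RightWreath.

Section LeftWreath.
Variables (d : Order.disp_t) (G : poGroupType d).

Fact lwreath_lt_irr :
  irreflexive (fun x y : lwreath G => `[< wreath_lt >=%R x y >]).
Proof. exact: wreath_ltb_irr. Qed.

Fact lwreath_lt_trans :
  transitive (fun x y : lwreath G => `[< wreath_lt >=%R x y >]).
Proof. exact: wreath_ltb_trans ge_total ge_anti ge_trans. Qed.

HB.instance Definition _ := Group.on (lwreath G).
HB.instance Definition _ :=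
  Order.Lt_isPOrder.Build d (lwreath G) lwreath_lt_irr lwreath_lt_trans.

Lemma lwreath_leP (x y : lwreath G) :
  x <= y <-> x = y \/ wreath_lt >=%R x y.
Proof.
rewrite le_eqVlt; split=> [/orP[/eqP|/asboolP]|[->|xy]]; auto.
  by rewrite eqxx.
by apply/orP; right; apply/asboolP.
Qed.

Fact lwreath_le_mul (x y a b : lwreath G) : a <= b -> x * a * y <= x * b * y.
Proof.
move=> /lwreath_leP[->//|ab]; apply/lwreath_leP; right.
by apply: wreath_lt_mul ab => n i j; rewrite /= lerD2r.
Qed.

HB.instance Definition _ :=
  Group_isPOGroup.Build d (lwreath G) lwreath_le_mul.

End LeftWreath.

(* Main.v *)
Require Import Defs.
From mathcomp Require Import all_boot all_order all_algebra finmap.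
From mathcomp Require Import boolp zify.

(** If [u, v > 1] in a wreath product, every positive element of a copy of [G]
    placed at an index small enough for the ordering of indices lies below both
    [u] and [v].
    As [G] is directed and non-commutative, its positive cone is
    non-commutative, so the commutation clause of RDP_1 forces [c12 = 1] or
    [c21 = 1] in every decomposition; this makes [a1 = c11 c12] and
    [b1 = c11 c21] comparable, and so the wreath product, which is directed, is
    linearly ordered. *)

Set Implicit Arguments.
Unset Strict Implicit.
Unset Printing Implicit Defensive.

Import Order.TTheory GRing.Theory Num.Theory.

Local Open Scope order_scope.
Local Open Scope group_scope.

(** * RDP_1 and linear order in an arbitrary po-group *)

Section POGroupTheory.
Variables (d : Order.disp_t) (G : poGroupType d).
Implicit Types x y g h : G.

Lemma le_mull g x y : (g * x <= g * y) = (x <= y).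
Proof.
apply/idP/idP => [/(le_mulg2 g^-1 1 _ _)|/(le_mulg2 g 1 _ _)]; rewrite !mulg1 //.
by rewrite !mulKg.
Qed.

Lemma le_mulr g x y : (x * g <= y * g) = (x <= y).
Proof.
apply/idP/idP => [/(le_mulg2 1 g^-1 _ _)|/(le_mulg2 1 g _ _)]; rewrite !mul1g //.
by rewrite !mulgK.
Qed.

Lemma ge1_mulVl x y : (1 <= x^-1 * y) = (x <= y).
Proof. by rewrite -(le_mull x 1) mulg1 mulVKg. Qed.

(** Taking the smaller of [a1] and [b1] as [c11] makes [c12] or [c21] trivial, and the commutation
    clause then only concerns [1]. *)
Lemma linearly_ordered_RDP1 : linearly_ordered G -> RDP1 G.
Proof.
move=> linG a1 a2 b1 b2 a1_ge1 a2_ge1 b1_ge1 b2_ge1 eab.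
have [ab|ba] := orP (linG a1 b1).
- exists a1, 1, (a1^-1 * b1), b2; split.
  + by rewrite ge1_mulVl.
  + by rewrite mulg1 mul1g mulVKg -mulgA -eab mulKg.
  + by move=> x y; rewrite -eq_le => /eqP <- _; rewrite mul1g mulg1.
- exists b1, (b1^-1 * a1), 1, a2; split.
  + by rewrite ge1_mulVl.
  + by rewrite mulg1 mul1g mulVKg -mulgA eab mulKg.
  + by move=> x y _; rewrite -eq_le => /eqP <-; rewrite mul1g mulg1.
Qed.

Lemma RDP1_linearly_ordered :
    directed G ->
    (forall u v, 1 < u -> 1 < v ->
       exists x y, [/\ 1 <= x <= u, 1 <= y <= v & x * y <> y * x]) ->
  RDP1 G -> linearly_ordered G.
Proof.
move=> dirG ncG rdpG x y.
(* Translating by [g] makes [x] and [y] positive; an upper bound [w] of the translates then has both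
   as left factors with positive cofactors, so RDP_1 applies. *)
have [g [xg yg]] := dirG x^-1 y^-1.
have pos z : z^-1 <= g -> 1 <= g * z by rewrite -(le_mulr z) mulVg.
have [w [xw yw]] := dirG (g * x) (g * y).
have eqw : (g * x) * ((g * x)^-1 * w) = (g * y) * ((g * y)^-1 * w).
  by rewrite !mulVKg.
have [|||| c11 [c12 [c21 [c22]]]] := rdpG _ _ _ _ _ _ _ _ eqw;
  rewrite ?ge1_mulVl ?pos //.
case=> -[_ c12_ge1 c21_ge1 _] [ex _ ey _] com.
(* Cancelling [g] and [c11] leaves the comparability of [c12] and [c21]. It is clear if one of them
   is [1]; otherwise [ncG] contradicts [com]. *)
rewrite -(le_mull g) -(le_mull g y) ex ey !le_mull.
move: c12_ge1 c21_ge1; rewrite !le_eqVlt.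
move=> /predU1P[<-|c12_gt1].
  by case/predU1P => [<-|->]; rewrite ?eqxx ?orbT.
move=> /predU1P[<-|c21_gt1]; first by rewrite c12_gt1 !orbT.
by have [u [v [/com cu /cu cv /(_ cv)]]] := ncG _ _ c12_gt1 c21_gt1.
Qed.

(** In a directed group every element is a quotient of two positive ones, so commutation of the
    positive cone would spread to the whole group. *)
Lemma noncommuting_gt1 :
    directed G -> ~ (forall g h : G, commute g h) ->
  exists g h, [/\ 1 < g, 1 < h & g * h <> h * g].
Proof.
move=> dirG ncG; apply: contrapT => com; apply: ncG.
have com1 g h : 1 <= g -> 1 <= h -> commute g h.
  rewrite !le_eqVlt => /predU1P[<- _|g_gt1]; first exact/commute_sym/commute1.
  move=> /predU1P[<-|h_gt1]; first exact: commute1.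
  by apply: contrapT => ngh; apply: com; exists g, h.
have quot x : exists p q, [/\ 1 <= p, 1 <= q & x = p * q^-1].
  have [p [xp p_ge1]] := dirG x 1.
  by exists p, (x^-1 * p); rewrite ge1_mulVl invgM invgK mulVKg.
have comq g x : 1 <= g -> commute g x.
  move=> g1; have [p [q [p1 q1 ->]]] := quot x.
  by apply: commuteM; [|apply: commuteV]; apply: com1.
move=> x y; have [p [q [p1 q1 ->]]] := quot x.
by apply/commute_sym/commuteM; [|apply: commuteV]; apply/commute_sym/comq.
Qed.

End POGroupTheory.

(** This supplies the index [i0] of the wreath order among the finitely many indices where two
    elements differ. *)
Lemma exists_last (T : eqType) (r : rel T) (s : seq T) :
    total r -> transitive r -> s != [::] ->
  exists2 m, m \in s & forall i, i \in s -> r i m.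
Proof.
move=> r_total r_trans; elim: s => // a s IHs _.
have rr i : r i i by have := r_total i i; rewrite orbb.
have [->|/IHs[m ms maxm]] := eqVneq s [::].
  by exists a; rewrite ?mem_head // => i; rewrite inE => /eqP ->.
have [am|ma] := orP (r_total a m).
- by exists m => [|i]; rewrite inE ?ms ?orbT // => /predU1P[->|/maxm].
- exists a => [|i]; rewrite ?mem_head // inE => /predU1P[->//|/maxm im].
  exact: r_trans im ma.
Qed.

(** * Copies of [G] in the wreath product, and its order for a general order [r] of the indices *)

Section Wreath.
Variables (d : Order.disp_t) (G : poGroupType d) (r : rel int).
Implicit Types x y u v : wreath G.

(** The integer component [0] avoids any shift, so each fixed [k] gives an embedding of the group
    [G]. *)
Definition wreath_single (k : int) (g : G) : wreath G :=
  (0%R, [fsfun i in [fset k]%fset => g | 1]).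

Lemma wreath_singleE k g i : (wreath_single k g).2 i = if i == k then g else 1.
Proof. by rewrite fsfunE inE. Qed.

Lemma wreath1E i : (1 : wreath G).2 i = 1.
Proof. exact: wreath_oneE. Qed.

Lemma wreath_singleM k g h :
  wreath_single k g * wreath_single k h = wreath_single k (g * h).
Proof.
apply: wreathP => // i; rewrite mulwE /= addr0 !wreath_singleE.
by case: eqP => //; rewrite mulg1.
Qed.

Lemma wreath_single_inj k : injective (wreath_single k).
Proof.
by move=> g h /(congr1 (fun x => x.2 k)); rewrite !wreath_singleE eqxx.
Qed.

Lemma wreath_lt_single_inv k g h :
  wreath_lt r (wreath_single k g) (wreath_single k h) -> g < h.
Proof.
case=> [|[_ [i [_ _]]]]; first by rewrite ltxx.
by rewrite !wreath_singleE; case: eqP => //; rewrite ltxx.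
Qed.

Hypothesis r_total : total r.

Lemma r_refl i : r i i.
Proof. by have := r_total i i; rewrite orbb. Qed.

Lemma wreath_lt1_single k g : 1 < g -> wreath_lt r 1 (wreath_single k g).
Proof.
move=> g_gt1; right; split=> //; exists k; split.
- by rewrite wreath1E wreath_singleE eqxx lt_eqF.
- move=> i; rewrite wreath1E wreath_singleE.
  by case: (i =P k) => [-> _|]; rewrite ?r_refl ?eqxx.
- by rewrite wreath1E wreath_singleE eqxx.
Qed.

Hypothesis r_trans : transitive r.

Lemma wreath_lt_single u :
    wreath_lt r 1 u ->
  exists i, forall k g, r k i -> k != i -> wreath_lt r (wreath_single k g) u.
Proof.
case=> [u1|[u1 [i [ui_neq maxi ui]]]].
  (* A positive integer component of [u] already dominates, so the threshold [0] is arbitrary. *)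
  by exists 0%R => k g _ _; left.
(* Here [i] is the last index of the support of [u]; an element placed strictly before it leaves [i]
   the last difference. *)
exists i => k g rki nki; right; split=> //; exists i.
have nik : (i == k) = false by rewrite eq_sym (negbTE nki).
move: ui_neq ui; rewrite !wreath1E wreath_singleE nik.
split=> // j.
rewrite wreath_singleE; case: (j =P k) => [->//|_] uj.
by apply: maxi; rewrite wreath1E.
Qed.

Hypothesis r_unbounded :
  forall i j, exists k, [/\ r k i, r k j, k != i & k != j].

Lemma wreath_intervals_noncommuting u v :
    directed G -> ~ (forall g h : G, commute g h) ->
    wreath_lt r 1 u -> wreath_lt r 1 v ->
  exists x y, [/\ wreath_lt r 1 x /\ wreath_lt r x u,
    wreath_lt r 1 y /\ wreath_lt r y v & x * y <> y * x].
Proof.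
move=> dirG ncG /wreath_lt_single[i ui] /wreath_lt_single[j vj].
have [g [h [g1 h1 ngh]]] := noncommuting_gt1 dirG ncG.
have [k [ki kj nki nkj]] := r_unbounded i j.
(* Both elements sit at the same index, because copies of [G] at distinct indices commute. *)
exists (wreath_single k g), (wreath_single k h); split.
- by split; [apply: wreath_lt1_single|apply: ui].
- by split; [apply: wreath_lt1_single|apply: vj].
- by rewrite !wreath_singleM => /wreath_single_inj.
Qed.

Lemma wreath_lt_directed x y :
  exists z, wreath_lt r x z /\ wreath_lt r y z.
Proof.
exists ((Num.max x.1 y.1 + 1)%R, x.2).
by split; left; rewrite /= ltzD1 le_max lexx ?orbT.
Qed.

Lemma wreath_lt_total x y :
    linearly_ordered G ->
  [\/ x = y, wreath_lt r x y | wreath_lt r y x].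
Proof.
move=> linG; have [xy|xy|exy] := ltgtP x.1 y.1.
- by constructor 2; left.
- by constructor 3; left.
pose D := [seq i <- enum_fset (finsupp x.2 `|` finsupp y.2)%fset
             | x.2 i != y.2 i].
(* Outside both supports [x] and [y] take the default value [1], so the finite list [D] misses no
   difference. *)
have memD i : (i \in D) = (x.2 i != y.2 i).
  rewrite mem_filter andbC; case: eqP => [|nxy]; first by rewrite andbF.
  rewrite andbT; apply/negbNE; apply/negP; rewrite inE negb_or.
  by case/andP=> /fsfun_dflt xi /fsfun_dflt yi; case: nxy; rewrite xi yi.
have [D0|/(exists_last r_total r_trans)[m]] := eqVneq D [::].
  constructor 1; apply: wreathP => // i.
  by apply/eqP; rewrite -[_ == _]negbK -memD D0.
rewrite memD => nm maxm.
have {}maxm i : x.2 i != y.2 i -> r i m by rewrite -memD => /maxm.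
have [lexy|leyx] := orP (linG (x.2 m) (y.2 m)).
- by constructor 2; right; split=> //; exists m; rewrite lt_neqAle nm.
- constructor 3; right; split=> //; exists m.
  by rewrite lt_neqAle eq_sym nm; split=> // i; rewrite eq_sym => /maxm.
Qed.

End Wreath.

(** * Transfer to the right and left wreath products *)

Section WreathOrderTransfer.
Variables (d : Order.disp_t) (G : poGroupType d).

Lemma rwreath_ltP (x y : rwreath G) : x < y <-> wreath_lt <=%R x y.
Proof. by split=> /asboolP. Qed.

Lemma lwreath_ltP (x y : lwreath G) : x < y <-> wreath_lt >=%R x y.
Proof. by split=> /asboolP. Qed.

Lemma linearly_ordered_rwreath :
  linearly_ordered G -> linearly_ordered (rwreath G).
Proof.
move=> linG x y.
have [->|/rwreath_ltP/ltW->|/rwreath_ltP/ltW->] :=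
  wreath_lt_total (@le_total _ int) le_trans x y linG; by rewrite ?lexx ?orbT.
Qed.

Lemma linearly_ordered_lwreath :
  linearly_ordered G -> linearly_ordered (lwreath G).
Proof.
move=> linG x y.
have [->|/lwreath_ltP/ltW->|/lwreath_ltP/ltW->] :=
  wreath_lt_total (@ge_total _ int) ge_trans x y linG; by rewrite ?lexx ?orbT.
Qed.

(** The copy of [G] at index [0] reflects the order. *)
Lemma rwreath_linearly_ordered :
  linearly_ordered (rwreath G) -> linearly_ordered G.
Proof.
move=> linW g h.
have {linW}/orP[] := linW (wreath_single 0%R g) (wreath_single 0%R h);
  move=> /rwreath_leP[/wreath_single_inj->|/wreath_lt_single_inv/ltW->];
  by rewrite ?lexx ?orbT.
Qed.

Lemma lwreath_linearly_ordered :
  linearly_ordered (lwreath G) -> linearly_ordered G.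
Proof.
move=> linW g h.
have {linW}/orP[] := linW (wreath_single 0%R g) (wreath_single 0%R h);
  move=> /lwreath_leP[/wreath_single_inj->|/wreath_lt_single_inv/ltW->];
  by rewrite ?lexx ?orbT.
Qed.

Hypothesis noncomm : ~ (forall g h : G, commute g h).
Hypothesis dirG : directed G.

Lemma RDP1_rwreath : RDP1 (rwreath G) -> linearly_ordered (rwreath G).
Proof.
apply: RDP1_linearly_ordered => [x y|u v /rwreath_ltP u1 /rwreath_ltP v1].
  have [z [/rwreath_ltP/ltW xz /rwreath_ltP/ltW yz]] :=
    wreath_lt_directed <=%R x y.
  by exists z.
have [|x [y [[/rwreath_ltP x1 /rwreath_ltP xu]]]] :=
    wreath_intervals_noncommuting (@le_total _ int) _ dirG noncomm u1 v1.
  move=> i j; exists (Num.min i j - 1)%R.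
  by split; lia.
move=> [/rwreath_ltP y1 /rwreath_ltP yv] nxy.
by exists x, y; rewrite !ltW.
Qed.

Lemma RDP1_lwreath : RDP1 (lwreath G) -> linearly_ordered (lwreath G).
Proof.
apply: RDP1_linearly_ordered => [x y|u v /lwreath_ltP u1 /lwreath_ltP v1].
  have [z [/lwreath_ltP/ltW xz /lwreath_ltP/ltW yz]] :=
    wreath_lt_directed >=%R x y.
  by exists z.
have [|x [y [[/lwreath_ltP x1 /lwreath_ltP xu]]]] :=
    wreath_intervals_noncommuting (@ge_total _ int) _ dirG noncomm u1 v1.
  (* For [>=] the earlier indices are the numerically greater ones. *)
  move=> i j; exists (Num.max i j + 1)%R.
  by split; lia.
move=> [/lwreath_ltP y1 /lwreath_ltP yv] nxy.
by exists x, y; rewrite !ltW.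
Qed.

End WreathOrderTransfer.

(* [all_algebra] shadows [mul], which below is the group law of [monoid]. *)
From mathcomp Require Import all_boot all_order.

Theorem proposition5p4 (d : Order.disp_t) (G : poGroupType d)
    (noncomm : ~ commutative (@mul G)) (dirG : directed G) :
  ((RDP1 (rwreath G) <-> RDP1 (lwreath G)) /\
   (RDP1 (lwreath G) <-> linearly_ordered G)) /\
  (RDP1 (rwreath G) \/ RDP1 (lwreath G) \/ linearly_ordered G ->
   linearly_ordered (rwreath G) /\ linearly_ordered (lwreath G)).
Proof.
have rG : RDP1 (rwreath G) -> linearly_ordered G.
  by move/(RDP1_rwreath noncomm dirG)/rwreath_linearly_ordered.
have lG : RDP1 (lwreath G) -> linearly_ordered G.
  by move/(RDP1_lwreath noncomm dirG)/lwreath_linearly_ordered.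
have Gr : linearly_ordered G -> RDP1 (rwreath G).
  by move/linearly_ordered_rwreath/linearly_ordered_RDP1.
have Gl : linearly_ordered G -> RDP1 (lwreath G).
  by move/linearly_ordered_lwreath/linearly_ordered_RDP1.
split; first by split; split; auto.
move=> rdp; have linG : linearly_ordered G by case: rdp => [|[|]]; auto.
by split; [apply: linearly_ordered_rwreath|apply: linearly_ordered_lwreath].
Qed.
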